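(* For every integer $n\geqslant1$, $|\mathrm{PwEnd}(S_n)|=2(n+1)^{n-1}+(n-1)3^{n-1}$.
   Context: For $n\geqslant1$, the star graph $S_n$ is the simple graph with vertex set $\{0,1,\ldots,n-1\}$ and edge set $E=\{\{0,i\}\mid 1\leqslant i\leqslant n-1\}$. For a finite simple graph $G=(V,E)$, $\mathrm{PwEnd}(G)$ is the set of all partial weak endomorphisms of $G$, i.e. partial maps $\alpha:V\to V$ (including the empty one; written on the right) such that for all $u,v\in\mathrm{Dom}(\alpha)$, $\{u,v\}\in E$ and $u\alpha\neq v\alpha$ imply $\{u\alpha,v\alpha\}\in E$. *)

(* Defs.v *)
From HB Require Import structures.
From mathcomp Require Import all_boot.
Set Implicit Arguments. Unset Strict Implicit. Unset Printing Implicit Defensive.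

Record sgraph := SGraph {
  vertex :> finType;
  edges : {set {set vertex}};
  edges_card2 : forall e, e \in edges -> #|e| = 2
}.

(* A partial map V -> V is a finite function V -> option V, where None means
   "undefined"; distinct partial maps are distinct finite functions, so
   cardinalities of sets of partial maps are the intended ones. *)
Definition pmap_on (V : finType) := {ffun V -> option V}.

(* The images of u and v are bound by the pattern exactly when both u and v lie
   in the domain of a (cf. PwEndP). *)
Definition partial_weak_endo (G : sgraph) (a : pmap_on G) : bool :=
  [forall u : G, forall v : G,
    if (a u, a v) is (Some u', Some v')
    then ([set u; v] \in edges G) && (u' != v') ==> ([set u'; v'] \in edges G)
    else true].

Definition PwEnd (G : sgraph) : {set pmap_on G} :=
  [set a : pmap_on G | partial_weak_endo a].

Lemma PwEndP (G : sgraph) (a : pmap_on G) :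
  reflect
    (forall u v u' v' : G, a u = Some u' -> a v = Some v' ->
       [set u; v] \in edges G -> u' <> v' -> [set u'; v'] \in edges G)
    (a \in PwEnd G).
Proof.
rewrite inE; apply: (iffP forallP) => [H u v u' v' au av uv /eqP ne | H u].
  by have /forallP/(_ v) := H u; rewrite au av uv ne.
apply/forallP => v; case au: (a u) => [u'|] //; case av: (a v) => [v'|] //.
by apply/implyP => /andP[uv /eqP ne]; exact: H au av uv ne.
Qed.

Definition star_edges (n : nat) : {set {set 'I_n}} :=
  [set [set z; i] | z in [set z : 'I_n | val z == 0],
                    i in [set i : 'I_n | 1 <= val i]].

Lemma star_edges_card2 (n : nat) (e : {set 'I_n}) :
  e \in star_edges n -> #|e| = 2.
Proof.
case/imset2P => z i; rewrite !inE => /eqP z0 i1 ->.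
by rewrite cards2; case: eqP => // zi; rewrite -zi z0 in i1.
Qed.

Definition star (n : nat) : sgraph := SGraph (@star_edges_card2 n).

(* Main.v *)
Require Import Defs.
From HB Require Import structures.
From mathcomp Require Import all_boot.

(* The images of the leaves can be chosen independently of each other once the
   image of the centre 0 is fixed. If it is undefined or 0, every leaf has all
   n + 1 choices, since 0 is equal or adjacent to every vertex. If it is a leaf
   j, every leaf must be undefined or go to 0 or j, hence 3 choices. *)

Lemma star_edgesE (m : nat) (u v : 'I_m.+1) :
  ([set u; v] \in star_edges m.+1) = ((u == ord0) != (v == ord0)).
Proof.
apply/imset2P/idP => [[z i]|].
  rewrite !inE => /eqP z0 i1.
  have {z0}-> : z = ord0 by apply: val_inj.
  move=> /setP uv.
  have ni : i != ord0 by rewrite -val_eqE /= -lt0n.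
  (* Testing two points suffices: if [u] and [v] were both the centre, the set would miss [i]; if
     both were leaves, it would miss [ord0]. *)
  have := uv ord0; have := uv i; rewrite !inE !eqxx orbT /=.
  case: (u =P ord0) => [->|/eqP nu]; case: (v =P ord0) => [->|/eqP nv] //=.
    by rewrite (negbTE ni).
  by move=> _; rewrite ![ord0 == _]eq_sym (negbTE nu) (negbTE nv).
have leaf (w : 'I_m.+1) : w != ord0 -> w \in [set i : 'I_m.+1 | 1 <= val i].
  by rewrite inE -val_eqE -lt0n.
have centre : ord0 \in [set z : 'I_m.+1 | val z == 0] by rewrite inE.
case: (u =P ord0) => [->|/eqP nu]; case: (v =P ord0) => [->|/eqP nv] // _.
  by exists ord0 v => //; apply: leaf.
by exists ord0 u; rewrite ?leaf // setUC.
Qed.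

Definition leaf_images {m : nat} (c : option 'I_m.+1) : {set option 'I_m.+1} :=
  if c is Some j then
    if j == ord0 then setT else [set None; Some ord0; Some j]
  else setT.

(** Every edge joins the centre to one leaf, so each constraint involves a single leaf and the image
    of the centre. *)
Lemma PwEnd_starE (m : nat) (a : pmap_on (star m.+1)) :
  (a \in PwEnd (star m.+1)) =
  [forall x : 'I_m.+1, (x != ord0) ==> (a x \in leaf_images (a ord0))].
Proof.
apply/PwEndP/forallP => [H x | H u v u' v' au av].
  apply/implyP => nx; rewrite /leaf_images.
  case a0: (a ord0) => [j|]; last by rewrite inE.
  case: (j =P ord0) => [_|/eqP nj]; first by rewrite inE.
  case ax: (a x) => [y|]; rewrite !inE //=.
  rewrite !(inj_eq (@Some_inj _)).
  case: (y =P j) => [|nyj]; first by rewrite orbT.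
  have := H ord0 x j y a0 ax; rewrite !star_edgesE eqxx (negbTE nx) (negbTE nj).
  by move/(_ isT (fun e => nyj (esym e))); case: (y == ord0).
(* Edges are unordered, so it suffices to treat those written from the centre. *)
have key (x j y : 'I_m.+1) : a ord0 = Some j -> a x = Some y ->
    x != ord0 -> j <> y -> (j == ord0) != (y == ord0).
  move=> a0 ax nx jy; have := H x; rewrite nx ax a0 /leaf_images /=.
  case: (j =P ord0) jy => [-> /eqP|nj jy]; first by rewrite eq_sym => /negbTE->.
  rewrite !inE /= !(inj_eq (@Some_inj _)) => /orP[->|/eqP yj] //.
  by case: jy.
rewrite !star_edgesE.
case: (u =P ord0) au => [->|/eqP nu] au; case: (v =P ord0) av => [->|/eqP nv] av //.
  by move=> _; apply: key au av nv.
by move=> _ ne; rewrite eq_sym; apply: key av au nu _ => /esym.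
Qed.

Lemma card_PwEnd_star_centre (m : nat) (c : option 'I_m.+1) :
  #|[set a in PwEnd (star m.+1) | a ord0 == c]| = #|leaf_images c| ^ m.
Proof.
(* The singleton at the centre turns the fibre over [c] into a full product of sets; it contributes
   a factor 1, and the [m] leaves give the power. *)
pose F (x : 'I_m.+1) := if x == ord0 then [set c] else leaf_images c.
transitivity #|(family F : {pred pmap_on (star m.+1)})|.
  apply: eq_card => a; rewrite inE PwEnd_starE.
  apply/andP/familyP => [[/forallP H /eqP a0] x | H].
    rewrite /F; case: (x =P ord0) => [->|/eqP nx]; first by rewrite inE a0.
    by have := H x; rewrite nx a0.
  have a0 : a ord0 = c by have := H ord0; rewrite /F eqxx inE => /eqP.
  split; last exact/eqP.
  by apply/forallP => x; apply/implyP => nx; have := H x; rewrite /F (negbTE nx) a0.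
rewrite card_family foldrE big_map big_enum big_ord_recl /= {1}/F eqxx cards1 mul1n.
by rewrite (eq_bigr (fun=> #|leaf_images c|)) // prod_nat_const card_ord.
Qed.

Theorem corollary1p2 (n : nat) (hn : 1 <= n) :
  #|PwEnd (star n)| = 2 * (n + 1) ^ (n - 1) + (n - 1) * 3 ^ (n - 1).
Proof.
case: n hn => [//|m] _; rewrite addn1 subn1 /=.
rewrite -sum1_card.
(* Sort the maps by the image of the centre. *)
rewrite (partition_big (fun a : pmap_on (star m.+1) => a ord0) predT) //=.
rewrite (eq_bigr (fun c => #|leaf_images c| ^ m)); last first.
  move=> c _; rewrite -card_PwEnd_star_centre -sum1_card.
  by apply: eq_bigl => a; rewrite !inE.
(* [None] and [Some ord0] each contribute [m.+2 ^ m], whence the factor 2; the values left are the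
   leaves. *)
rewrite (bigD1 None) //= (bigD1 (Some ord0)) //= addnA.
rewrite cardsT card_option card_ord addnn -mul2n; congr (_ + _).
rewrite (eq_bigr (fun=> 3 ^ m)) => [|[j|] //= /negbTE nj].
  rewrite sum_nat_const; congr (_ * _).
  (* Removing [None] and [Some ord0] from the [m.+2] values leaves [m]. *)
  have := cardsT (option 'I_m.+1); rewrite card_option card_ord.
  rewrite (cardsD1 None) (cardsD1 (Some ord0)) !inE /= !add1n => -[card_m].
  by rewrite -[RHS]card_m; apply: eq_card => c; rewrite !inE andbT andbC.
have {}nj : (j == ord0) = false by rewrite -nj (inj_eq (@Some_inj _)).
(* The three allowed values are distinct because [j] is not the centre. *)
by rewrite nj setUC cardsU1 cards2 !inE /= !(inj_eq (@Some_inj _)) nj.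
Qed.
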